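(* For every cardinal $\kappa$ satisfying $\kappa^{\mathfrak{c}} = \kappa$ there is a dense subspace $X$ of the Cantor cube $\mathbb{C}_\kappa$ such that $X$ has countable pseudocharacter and $(\mathfrak{c},\omega)$ is a dominating pair for $X$.
   Context: $\mathfrak{c} = 2^\omega$; $\kappa$ is an infinite cardinal. $\mathbb{C}_\kappa$ denotes the Cantor cube $\{0,1\}^\kappa$ with the product topology. For cardinals $\mu > \lambda \ge \omega$, $(\mu,\lambda)$ is a dominating pair for a topological space $X$ if for every $A \subset X$ with $|A| \le \mu$ there is $B \subset X$ with $|B| \le \lambda$ such that $A \subset \overline{B}$ (closure in $X$). $X$ has countable pseudocharacter if for every $x \in X$ the singleton $\{x\}$ is the intersection of countably many open subsets of $X$. *)

(* Defs.v *)
From mathcomp Require Import all_boot all_order.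
From mathcomp Require Import all_classical topology borel_hierarchy.

Set Implicit Arguments.
Unset Strict Implicit.
Unset Printing Implicit Defensive.

Local Open Scope classical_set_scope.
Local Open Scope card_scope.

(* Cardinals are represented by types: a type K stands for the cardinality of
   [set: K], cardinals are compared with #<= and #=, and the cardinal power
   |K|^|J| is the cardinality of the function type J -> K. *)

(* Stands for the cardinal 2^omega. *)
Definition continuum : Type := nat -> bool.

(* bool carries the discrete topology. *)
Definition cantor_cube (K : Type) : topologicalType := {ptws K -> bool}.

Definition countable_pseudocharacter (T : topologicalType) : Prop :=
  forall x : T, Gdelta [set x].

(* The first three clauses say that M > L >= omega, which is part of the notion
   of a dominating pair (M, L). *)
Definition dominating_pair (M L : Type) (T : topologicalType) : Prop :=
  [/\ [set: nat] #<= [set: L],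
      [set: L] #<= [set: M],
      ~ ([set: M] #<= [set: L]) &
      forall A : set T, A #<= [set: M] ->
        exists B : set T, B #<= [set: L] /\ A `<=` closure B].

(* Main.v *)
Require Import Defs.
From mathcomp Require Import all_boot all_order.
From mathcomp Require Import all_classical topology borel_hierarchy.
From mathcomp Require Import zify.

Local Open Scope classical_set_scope.
Local Open Scope card_scope.

(** Split the coordinates into countable blocks indexed by K, and fix a
surjection [phi : K -> (continuum -> K)]. For each block [a], put into X a
countable family of points that vanish on every block outside
[range (phi a) `|` [set a]], form a Hewitt-Marczewski-Pondiczery dense set on
the blocks in [range (phi a)] other than [a], using only sequences that are
eventually 1, and carry on block [a] distinct sequences with exactly two 1's,
which accumulate at 0. A point of the family is then the only point of X with
its trace on block [a], so points of X are G_delta. A set A of at most continuum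
many points of X lives on at most continuum many blocks; by a diagonal argument
these are contained in [range (phi a)] for some [a] that is not one of them, so
A vanishes on block [a] and the countable family of [a] has A in its closure.
The same argument with finitely many blocks gives density. *)

Lemma inj_card_leT {T U : Type} (f : T -> U) :
  injective f -> [set: T] #<= [set: U].
Proof.
move=> f_inj; have fT : range f #= [set: T].
  by apply: inj_card_eq => x y _ _; exact: f_inj.
by rewrite -(card_le_eql fT); exact: card_leT.
Qed.

Lemma card_eqT_bij {T U : Type} :
  [set: T] #= [set: U] -> exists f : T -> U, bijective f.
Proof.
case/card_bijP => f [g fK gK].
exists (fun x => set_val (f (SigSub (mem_setT x)))).
exists (fun y => set_val (g (SigSub (mem_setT y)))) => x.
  by rewrite (_ : SigSub _ = f (SigSub (mem_setT x))) ?fK //; exact: val_inj.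
by rewrite (_ : SigSub _ = g (SigSub (mem_setT x))) ?gK //; exact: val_inj.
Qed.

Lemma card_le_range {T V : Type} (A : set T) (t : T) :
  A #<= [set: V] -> exists g : V -> T, A `<=` range g.
Proof.
case/pfcard_geP => [-> | [g]]; first by exists (fun=> t) => x.
by exists g; exact: surj.
Qed.

Lemma nat_continuum : [set: nat] #<= [set: continuum].
Proof.
apply: (inj_card_leT (fun n m => n == m)) => n m /(congr1 (@^~ m)) /=.
by rewrite eqxx => /eqP.
Qed.

Lemma continuum_nat : ~ ([set: continuum] #<= [set: nat]).
Proof.
case/(card_le_range _ ((fun=> false) : continuum)) => g.
move=> /(_ (fun n => ~~ g n n) I) [n _ gn].
by have := congr1 (@^~ n) gn => /=; case: (g n n).
Qed.

Lemma finite_set_nat_bounded (N : set nat) :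
  finite_set N -> exists b, forall n, N n -> (n < b)%N.
Proof.
case/finite_seqP => s ->; exists (\max_(n <- s) n).+1 => n ns.
by rewrite ltnS; exact: (leq_bigmax_seq (F := id)).
Qed.

(** Two distinct sequences differ at some index; [L] exceeds one such index for each of the finitely
    many pairs. *)
Lemma finite_separation {T : Type} (c : T -> continuum) (G : set T) :
  finite_set G -> exists L, forall x y, G x -> G y ->
    mkseq (c x) L = mkseq (c y) L -> c x = c y.
Proof.
move=> finG.
have /choice [d dP] : forall u : T * T, exists n, c u.1 n = c u.2 n -> c u.1 = c u.2.
  move=> u; have [|/existsNP[n cn]] := pselect (forall n, c u.1 n = c u.2 n).
    by move=> /funext cE; exists 0%N.
  by exists n => /cn.
have [L LP] := finite_set_nat_bounded _ (finite_image d (finite_setX finG finG)).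
exists L => x y Gx Gy cE; apply: (dP (x, y)) => /=.
have dL : (d (x, y) < L)%N by apply: LP; exists (x, y).
by have := congr1 (nth false ^~ (d (x, y))) cE; rewrite !nth_mkseq.
Qed.

Lemma nbhs_cantor_cube {K : Type} (a : cantor_cube K) (U : set (cantor_cube K)) :
  nbhs a U -> exists2 F : set K, finite_set F &
    forall y : cantor_cube K, (forall i, F i -> y i = a i) -> U y.
Proof.
pose G : set_system (cantor_cube K) := fun U => exists2 F : set K, finite_set F &
    forall y : cantor_cube K, (forall i, F i -> y i = a i) -> U y.
suff Ga : G --> a by exact: Ga.
(* Once [G] is a filter, its convergence to [a] can be checked one coordinate at a time. *)
have GF : Filter G.
  split.
  - by exists set0.
  - move=> P Q [F finF FP] [H finH HQ]; exists (F `|` H).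
      by rewrite finite_setU.
    by move=> y ya; split; [apply: FP|apply: HQ] => i ?; apply: ya; [left|right].
  - by move=> P Q PQ [F finF FP]; exists F => // y /FP /PQ.
apply/cvg_sup => i V [_ [[W oW <-] Wa WV]].
by exists [set i] => // y ya; apply: WV; rewrite /proj/= ya.
Qed.

Lemma open_coordinate {K : Type} (i : K) (b : bool) :
  open [set y : cantor_cube K | y i = b].
Proof.
rewrite openE => y yb; have /cvg_sup/(_ i) : y --> y by exact: cvg_id.
apply; exists [set y : K -> bool | y i = b]; split => //.
by exists [set b] => //; exact: discrete_open.
Qed.

Lemma two_points {K : Type} : infinite_set [set: K] ->
  exists k : bool -> K, k true <> k false.
Proof.
move=> infK; have /set0P[k0 _] : [set: K] != set0.
  by apply: contra_not_neq infK => ->; exact: finite_set0.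
suff [k1 k10] : exists k1, k1 <> k0 by exists (fun b => if b then k1 else k0).
apply: contrapT => /forallNP noK; apply: infK.
apply: (@sub_finite_set _ _ [set k0]) => // k _.
exact: contrapT (noK k).
Qed.

Definition bcons (b : bool) (s : continuum) : continuum :=
  fun n => if n is n'.+1 then s n' else b.

Definition btail (s : continuum) : continuum := fun n => s n.+1.

Lemma bij_prod_nat {K : Type} : infinite_set [set: K] ->
  [set: continuum -> K] #= [set: K] -> exists e : K -> K * nat, bijective e.
Proof.
move=> infK /card_eqT_bij[f /bij_inj f_inj].
have [k kTF] := two_points infK.
apply: card_eqT_bij; apply: Cantor_Bernstein.
  by apply: (inj_card_leT (fun k => (k, 0%N))) => x y [].
(* Sequences starting with [true] recover [u.1]; on the others, the indicator of [n] is sent to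
   [k true] only if [u.2 = n]. *)
pose h (u : K * nat) : continuum -> K :=
  fun s => if s 0%N then u.1 else k (btail s u.2).
apply: (inj_card_leT (f \o h)) => -[x n] [y m] /f_inj hE.
have <- : x = y := congr1 (@^~ (fun=> true)) hE.
have := congr1 (@^~ (bcons false (fun i => i == n))) hE.
rewrite /h /btail/= eqxx; case: eqP => [-> //|_ /kTF []].
Qed.

(* phi a extends f, and its remaining values make [phi a] differ from every
   [phi (f s)]. *)
Lemma diagonal_range {K : Type} (phi : K -> continuum -> K) :
  infinite_set [set: K] -> (forall f, exists a, phi a = f) ->
  forall f : continuum -> K, exists a, range f `<=` range (phi a) /\ ~ range f a.
Proof.
move=> infK phi_surj f; have [k kTF] := two_points infK.
pose diag s := k `[< phi (f s) (bcons true s) <> k true >].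
have [a aE] := phi_surj (fun s => if s 0%N then diag (btail s) else f (btail s)).
exists a; split=> [_ [s _ <-]|[s _ fs]].
  by exists (bcons false s) => //; rewrite aE.
have : phi (f s) (bcons true s) = diag s by rewrite fs aE.
rewrite /diag; case: asboolP => [//|/contrapT ->]; exact: kTF.
Qed.

(* Junk when [c] is not in [range (phi a)]. *)
Definition code {K : Type} (phi : K -> continuum -> K) (a c : K) : continuum :=
  get [set s | phi a s = c].

Lemma codeK {K : Type} (phi : K -> continuum -> K) (a c : K) :
  range (phi a) c -> phi a (code phi a c) = c.
Proof. by case=> s _ sc; apply: (@getPex _ [set s | phi a s = c]); exists s. Qed.

Definition datum : Type := nat * (nat * seq (seq bool * nat)).

(* Point number [w = (k, (L, T))] of block [a], at coordinate [c.2] of block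
   [c.1]. The two 1's on block [a] lie beyond any given finite set of coordinates
   once k is large, and their positions determine w. On a block in
   [range (phi a)], the finite list T records the zeros, and two blocks are told
   apart by the first L bits of their codes. *)
Definition point {K : Type} (phi : K -> continuum -> K) (a : K) (w : datum)
    (c : K * nat) : bool :=
  let: (k, (L, T)) := w in
  if `[< c.1 = a >] then (c.2 == k) || (c.2 == (k + pickle (L, T)).+1)
  else `[< range (phi a) c.1 >] && ((mkseq (code phi a c.1) L, c.2) \notin T).

(** If [a = b], the lower 1 on block [a] gives [k] and the gap to the other gives [(L, T)].
    Otherwise the point of block [b] is either zero or eventually 1 on block [a], so it cannot have
    exactly two 1's there. *)
Lemma point_inj {K : Type} (phi : K -> continuum -> K) (a b : K) (v w : datum) :
  (forall n, point phi b w (a, n) = point phi a v (a, n)) -> b = a /\ w = v.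
Proof.
case: v w => [k u] [l [L T]] E.
have [ba|ba] := pselect (a = b).
  split=> //; subst b; case: u E => L' T' E.
  move: E; rewrite /point/= asboolT// => E.
  have kl : l = k.
    have := E l; have := E k; rewrite !eqxx /= => /orP Ek /esym/orP El.
    by case: Ek => /eqP; case: El => /eqP; lia.
  subst l; have := E (k + pickle (L, T)).+1; rewrite eqxx orbT.
  case/esym/orP=> /eqP; first by lia.
  by case=> /addnI /(pcan_inj pickleK) ->.
exfalso; move: E; case: u => L' T'.
rewrite /point/= (asboolF ba) (asboolT (erefl a)) => E.
have [ra|ra] := pselect (range (phi b) a); last first.
  by have := E k; rewrite (asboolF ra) eqxx.
have [m mP] := finite_set_nat_bounded _ (finite_image snd (finite_seq T)).
(* This coordinate lies beyond both 1's of [v] and beyond every zero listed in [T]. *)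
have := E (m + k + pickle (L', T')).+2; rewrite (asboolT ra) /=.
rewrite [RHS](_ : _ = false); last by apply/negbTE/negP => /orP[] /eqP; lia.
by move/negbT; rewrite negbK => /(imageP snd) /mP /=; lia.
Qed.

Lemma point_approx {K : Type} (phi : K -> continuum -> K) (a : K)
    (t : K * nat -> bool) (F : set (K * nat)) :
  finite_set F ->
  (forall c, F c -> c.1 = a \/ ~ range (phi a) c.1 -> t c = false) ->
  exists w, forall c, F c -> point phi a w c = t c.
Proof.
move=> finF t0.
have [k kP] := finite_set_nat_bounded _ (finite_image snd finF).
have [L LP] := finite_separation (code phi a) _ (finite_image fst finF).
(* [G] collects the zeros that [T] must record; [L] keeps them from affecting other coordinates in
   [F]. *)
pose G := F `&` [set c | range (phi a) c.1 /\ t c = false].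
have /finite_seqP[T TE] :
    finite_set [set (mkseq (code phi a c.1) L, c.2) | c in G].
  by apply: finite_image; apply: sub_finite_set finF => c [].
exists (k, (L, T)) => c Fc; rewrite /point.
have ck : (c.2 < k)%N by apply: kP; exists c.
case: asboolP => [ca|ca].
  by rewrite t0//; [apply/negbTE/negP => /orP[] /eqP; lia|left].
case: asboolP => [rc|rc]; last by rewrite t0//; right.
have TP u : (u \in T) = `[< [set (mkseq (code phi a c.1) L, c.2) | c in G] u >].
  by rewrite TE; apply/idP/asboolP.
rewrite /= TP; case: asboolP => /= [[d [Fd [rd td]] [cE dc]]|nG].
  suff -> : c = d by rewrite td.
  rewrite [c]surjective_pairing [d]surjective_pairing dc; congr pair.
  rewrite -(codeK _ _ _ rc) -(codeK _ _ _ rd).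
  by congr (phi a _); apply/esym; apply: LP.
by apply/esym/negbNE/negP => /negbTE tc; apply: nG; exists c.
Qed.

(* set_type X, the type of the elements of X, carries the subspace
   topology. *)
Theorem mainTheorem9 (K : Type) (K_infinite : infinite_set [set: K])
    (K_power : [set: continuum -> K] #= [set: K]) :
  exists X : set (cantor_cube K),
    [/\ dense X,
        countable_pseudocharacter (set_type X) &
        dominating_pair continuum nat (set_type X)].
Proof.
have [e [e' eK e'K]] := bij_prod_nat K_infinite K_power.
have /card_eqT_bij[phi' [phi phi'K phiK]] := K_power.
have phi_surj f : exists a, phi a = f by exists (phi' f).
have diagP := diagonal_range _ K_infinite phi_surj.
pose P a w : cantor_cube K := fun i => point phi a w (e i).
pose X : set (cantor_cube K) := [set P u.1 u.2 | u in [set: K * datum]].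
have XP a w : X (P a w) by exists (a, w).
have [k _] := two_points K_infinite; pose k0 := k true.
exists X; split.
- move=> O [y Oy] oO.
  have [F finF FO] := nbhs_cantor_cube _ _ (open_nbhs_nbhs (conj oO Oy)).
  have finG : finite_set [set (e i).1 | i in F] by exact: finite_image.
  have [f Ff] := card_le_range _ k0
    (card_le_trans (finite_set_countable finG) nat_continuum).
  have [a [fa na]] := diagP f.
  have Fr i : F i -> range f (e i).1 by move=> Fi; apply: Ff; exists i.
  have [w wP] : exists w, forall c, [set e i | i in F] c ->
      point phi a w c = y (e' c).
    apply: point_approx; first exact: finite_image.
    move=> _ [i Fi <-] [ia|]; last by case; apply/fa/Fr.
    by case: na; rewrite -ia; exact: Fr.
  exists (P a w); split=> //; apply: FO => i Fi.
  by rewrite /P wP ?eK//; exists i.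
- move=> x; have [[a w] _ wx] := set_valP x.
  pose O n := [set y : cantor_cube K | y (e' (a, n)) = set_val x (e' (a, n))].
  exists (fun n => set_val @^-1` O n).
    by move=> n; exists (O n) => //; exact: open_coordinate.
  rewrite eqEsubset; split=> [_ -> n //|y yx].
  have [[b v] _ vy] := set_valP y.
  apply: val_inj; rewrite -wx -vy /=.
  have [|-> ->//] := point_inj phi a b w v.
  move=> n; have : set_val y (e' (a, n)) = set_val x (e' (a, n)) := yx n I.
  by rewrite -[set_val x]wx -[set_val y]vy /P e'K.
- split; [exact: card_lexx|exact: nat_continuum|exact: continuum_nat|].
  pose x0 : set_type X := SigSub (mem_set (XP k0 (0%N, (0%N, [::])))).
  move=> A /(card_le_range _ x0) [g gA].
  have /choice[h hP] : forall x : set_type X, exists h : continuum -> K,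
      forall c : K * nat, ~ range h c.1 -> set_val x (e' c) = false.
    move=> x; have [[a w] _ wx] := set_valP x.
    (* The point [x] can be nonzero only on its own block [a] and on blocks in [range (phi a)]; the
       first bit chooses between the two. *)
    exists (fun s => if s 0%N then a else phi a (btail s)) => c nc.
    rewrite -[set_val x]wx /P e'K /point; case: (w) => [l [L T]] /=.
    case: asboolP => [ca|_].
      by case: nc; exists (fun=> true).
    by case: asboolP => //= -[s _ sc]; case: nc; exists (bcons false s).
  (* Even bits choose a point through [g], odd bits a block through [h], so [range f] contains every
     block where some point of [A] is nonzero. *)
  pose f s := h (g (fun n => s n.*2)) (fun n => s n.*2.+1).
  have [a [fa na]] := diagP f.
  pose Q w : set_type X := SigSub (mem_set (XP a w)).
  exists (range Q); split.
    exact: card_le_trans (card_image_le _ _) (countableP _).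
  move=> x /gA[s _ sx] U /= [_ [[O oO <-] Ox] OU].
  have [F finF FO] := nbhs_cantor_cube _ _ (open_nbhs_nbhs (conj oO Ox)).
  have [w wP] : exists w, forall c, [set e i | i in F] c ->
      point phi a w c = set_val x (e' c).
    apply: point_approx; first exact: finite_image.
    have hr c : range (h x) c -> range f c.
      case=> t _ <-; exists (fun n => if odd n then t n./2 else s n./2) => //.
      rewrite -sx /f; congr (h (g _) _); apply/funext => n /=.
        by rewrite odd_double doubleK.
      by rewrite odd_double /= uphalf_double.
    move=> c _ cP; apply: hP => /hr rc; case: cP => [ca|]; last first.
      by apply; exact: fa.
    by apply: na; rewrite -ca.
  exists (Q w); split; first by exists w.
  apply: OU; apply: FO => i Fi; rewrite -[LHS]/(P a w i).
  by rewrite /P wP ?eK//; exists i.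
Qed.
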